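(* The geodesics for metrics of self-dual Taub-NUT type with constant $\theta$, $\varphi$, $\tau$ and passing through $r=n$ with conditions $$\lim_{r\to n} t=t_1,\qquad \lim_{r\to n}\sqrt{\frac{r+n}{r-n}}\,\frac{dr}{dt}=r_1$$ satisfy $$t(r)=t_1+\frac{1}{r_1}\left[\sqrt{r^2-n^2}+2n\ln\left(\sqrt{r+n}+\sqrt{r-n}\right)\right].$$
   Context: The metric of self-dual Taub-NUT type with parameter $n$ is $$ds^2=\frac{r-n}{r+n}(d\tau+2n\cos\theta\, d\varphi)^2+(r^2-n^2)(d\theta^2+\sin^2\theta\, d\varphi^2)+\frac{r+n}{r-n}dr^2$$ in coordinates $(\tau,r,\theta,\varphi)$. The apparent singularity at $r=n$ is removable, and the surfaces of constant $r>n$ are topologically 3-spheres. Geodesics are solutions of the geodesic equations of this metric with parameter $t$; along them $t$ is expressed as a function of $r$. Here $t_1$ and $r_1$ are constants.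
   Formalization: The bracket is corrected by subtracting n ln(2n), so that t tends to t_1 as r tends to n; as printed the formula contradicts that limit condition unless n = 1/2. Here n > 0, and the geodesic lies in r > n, 0 < θ < π. *)

(* Defs.v *)
From mathcomp Require Import all_boot all_order all_algebra.
From mathcomp Require Import all_classical all_reals all_analysis.

Set Implicit Arguments.
Unset Strict Implicit.
Unset Printing Implicit Defensive.

Import Order.TTheory GRing.Theory Num.Theory.
Import numFieldNormedType.Exports.

Local Open Scope ring_scope.
Local Open Scope classical_set_scope.

Section Geodesics.
Variables (R : realType) (m : nat).
Implicit Types (g : 'rV[R]_m -> 'M[R]_m) (p : 'rV[R]_m).

Definition metric_partial g (l i j : 'I_m) p : R :=
  'D_(delta_mx 0 l) (fun q => g q i j) p.

(* Christoffel symbol of the second kind, Gamma^k_(i j). *)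
Definition christoffel g (k i j : 'I_m) p : R :=
  2^-1 * \sum_l invmx (g p) k l *
    (metric_partial g i l j p + metric_partial g j l i p
     - metric_partial g l i j p).

Definition coordinate (x : R -> 'rV[R]_m) (k : 'I_m) : R -> R :=
  fun t => x t 0 k.

(* The curve x, restricted to the set I of parameters, is a geodesic of g that
   stays in the coordinate domain U. The parameter is affine, as is implied by
   the geodesic equation in this form. *)
Definition geodesic g (U : set 'rV[R]_m) (I : set R) (x : R -> 'rV[R]_m) :
    Prop :=
  forall t, I t ->
    U (x t) /\
    forall k : 'I_m,
      [/\ derivable (coordinate x k) t 1,
          derivable (derive1 (coordinate x k)) t 1 &
          derive1 (derive1 (coordinate x k)) t
          + \sum_i \sum_j christoffel g k i j (x t)
              * derive1 (coordinate x i) t * derive1 (coordinate x j) t = 0].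

End Geodesics.

(* Coordinates are ordered as (tau, r, theta, phi). *)
Definition i_tau : 'I_4 := @Ordinal 4 0 isT.
Definition i_r : 'I_4 := @Ordinal 4 1 isT.
Definition i_theta : 'I_4 := @Ordinal 4 2 isT.
Definition i_phi : 'I_4 := @Ordinal 4 3 isT.

Section TaubNUT.
Variables (R : realType) (n : R).

(* The coordinate covector d x^k, as a row vector. *)
Definition dcoord (k : 'I_4) : 'rV[R]_4 := delta_mx 0 k.

(* The symmetric matrix of the square w^2 of a covector w. *)
Definition covector_sq (w : 'rV[R]_4) : 'M[R]_4 := w^T *m w.

Definition taub_nut_metric (p : 'rV[R]_4) : 'M[R]_4 :=
  let r := p 0 i_r in
  let theta := p 0 i_theta in
  ((r - n) / (r + n)) *:
     covector_sq (dcoord i_tau + (2 * n * cos theta) *: dcoord i_phi)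
  + (r ^+ 2 - n ^+ 2) *:
     (covector_sq (dcoord i_theta)
      + (sin theta ^+ 2) *: covector_sq (dcoord i_phi))
  + ((r + n) / (r - n)) *: covector_sq (dcoord i_r).

(* The poles theta = 0, pi of the spheres and the locus r = n are excluded:
   the metric is regular there but these coordinates are not. *)
Definition taub_nut_chart : set 'rV[R]_4 :=
  [set p | n < p 0 i_r /\ 0 < p 0 i_theta < pi].

End TaubNUT.

(* Main.v *)
Require Import Defs.
From mathcomp Require Import all_boot all_order all_algebra.
From mathcomp Require Import all_classical all_reals all_analysis.
From mathcomp Require Import ring lra.

Set Implicit Arguments.
Unset Strict Implicit.
Unset Printing Implicit Defensive.

Import Order.TTheory GRing.Theory Num.Theory.
Import numFieldNormedType.Exports.

Local Open Scope ring_scope.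
Local Open Scope classical_set_scope.

(** With theta, phi and tau constant, the radial geodesic equation only involves
the Christoffel symbol Gamma^r_(r r). The coordinate r is orthogonal to the
others and g_rr = H(r) = (r + n) / (r - n) depends on r alone, so that
Gamma^r_(r r) = H'(r) / (2 H(r)), and the equation r'' = - Gamma^r_(r r) r'^2
says exactly that the speed sqrt(H(r)) r' of the curve is constant
([coordinate_line_speed_cst]). The constant is r1, by the second limit.

An antiderivative of sqrt(H), that is, the arc length along the radial lines up
to a constant, is
  F(r) = sqrt(r^2 - n^2) + 2 n ln (sqrt(r + n) + sqrt(r - n))
([is_derive_radial_arclength]). Hence F(r) - r1 t has derivative 0 along the
geodesic, and its constant value is read off as r tends to n, where F tends to
n ln (2 n) ([radial_arclength_cvg]) and t tends to t1.

Two points need an argument. The limits at n say something about the geodesic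
only because its image contains a whole interval ]n, r]: the image is an
interval, as the continuous image of one, and it accumulates at n. And r1 is not
0, since otherwise r would be constant along the geodesic.

The formula for Gamma^r_(r r) requires the matrix of the metric to be
invertible, which holds in the chart because the metric is positive definite
there ([taub_nut_quadratic_form], [taub_nut_metric_unit]). *)

(** * Derivatives on intervals and along coordinates *)

Lemma derive1_near_eq (R : realType) (f g : R -> R) (a : R) :
  (\near a, f a = g a) -> derive1 f a = derive1 g a.
Proof. by move=> fg; rewrite !derive1E; apply: near_eq_derive. Qed.

Lemma interval_derive0_cst (R : realType) (I : set R) (f : R -> R) :
  is_interval I -> (forall u, I u -> is_derive u 1 f 0) ->
  forall u v, I u -> I v -> f u = f v.
Proof.
move=> itvI f'0 u v Iu Iv.
wlog uv : u v Iu Iv / u <= v.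
  by move=> wl; case: (leP u v) => [|/ltW] ?; [|symmetry]; apply: wl.
have Iw w : w \in `[u, v]%R -> I w.
  by rewrite in_itv/= => uwv; exact: itvI Iu Iv _ uwv.
have [w /subset_itv_oo_cc/Iw/f'0//||w _] := @MVT_segment _ f (fun=> 0) _ _ uv.
  by apply: derivable_within_continuous => w /Iw/f'0 [].
by rewrite mul0r => /eqP; rewrite subr_eq0 => /eqP.
Qed.

(** Along p + h e_l the k-th coordinate moves at unit speed if l = k and not at
all otherwise; the difference quotients themselves agree, so H may be any
function. *)
Lemma derive_coord (R : realType) (m : nat) (H : R -> R) (k l : 'I_m)
    (p : 'rV[R]_m) :
  'D_(delta_mx 0 l) (fun q : 'rV[R]_m => H (q 0 k)) p
  = if l == k then derive1 H (p 0 k) else 0.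
Proof.
rewrite /derive /derive1.
case: eqVneq => [->|lk].
  rewrite (_ : (fun h : R => _) =
    fun h : R => h^-1 *: (H (h + p 0 k) - H (p 0 k)))//.
  by apply/funext => h /=; rewrite !mxE !eqxx mulr1.
rewrite (_ : (fun h : R => _) = cst 0); first exact: lim_cst.
apply/funext => h /=.
by rewrite !mxE (eq_sym k) (negPf lk) andbF mulr0 add0r subrr scaler0.
Qed.

(** * Geodesics along an orthogonal coordinate line *)

Section OrthogonalCoordinate.
Variables (R : realType) (m : nat) (g : 'rV[R]_m -> 'M[R]_m) (k : 'I_m).
Variable H : R -> R.
Hypothesis g_row : forall q l, g q k l = if l == k then H (q 0 k) else 0.
Hypothesis g_col : forall q l, g q l k = if l == k then H (q 0 k) else 0.

(** Only the term l = k of the sum survives: for l != k both g_(k l) and the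
derivative of g_(k k) in the direction l vanish. Since the row and the column k
of g are zero off the diagonal, the corresponding entry of the inverse matrix is
1 / H. *)
Lemma christoffel_orthogonal (p : 'rV[R]_m) : g p \in unitmx ->
  christoffel g k k k p = derive1 H (p 0 k) / (2 * H (p 0 k)).
Proof.
move=> gU.
have gkk : (fun q => g q k k) = (fun q => H (q 0 k)).
  by apply/funext => q; rewrite g_row eqxx.
rewrite /christoffel (bigD1 k)//= big1 => [|l lk]; last first.
  have glk : (fun q => g q l k) = cst 0.
    by apply/funext => q; rewrite g_col (negPf lk).
  rewrite /metric_partial glk gkk derive_cst derive_coord (negPf lk).
  by rewrite addr0 subr0 mulr0.
have invH : invmx (g p) k k * H (p 0 k) = 1.
  have := mulVmx gU => /matrixP/(_ k k); rewrite !mxE eqxx (bigD1 k)//=.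
  rewrite g_row eqxx big1 ?addr0// => l lk.
  by rewrite g_col (negPf lk) mulr0.
have H0 : H (p 0 k) != 0.
  apply/eqP => H0; move: invH; rewrite H0 mulr0 => /esym/eqP.
  by rewrite oner_eq0.
rewrite /metric_partial gkk derive_coord eqxx.
have -> : invmx (g p) k k = (H (p 0 k))^-1.
  by rewrite -[RHS]mul1r -invH mulfK.
by field.
Qed.

Variables (U : set 'rV[R]_m) (I : set R) (x : R -> 'rV[R]_m).
Hypothesis openI : open I.
Hypothesis itvI : is_interval I.
Hypothesis geo : geodesic g U I x.
Hypothesis cst_coord : forall l, l != k ->
  forall u v, I u -> I v -> coordinate x l u = coordinate x l v.
Hypothesis gU : forall q, U q -> g q \in unitmx.
Hypothesis H_gt0 : forall q, U q -> 0 < H (q 0 k).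
Hypothesis H_derivable : forall q, U q -> derivable H (q 0 k) 1.

Lemma coordinate_line_geodesic (u : R) : I u ->
  derive1 (derive1 (coordinate x k)) u =
  - (derive1 H (x u 0 k) / (2 * H (x u 0 k))
     * derive1 (coordinate x k) u ^+ 2).
Proof.
move=> Iu; have [Ux /(_ k)[_ _ +]] := geo Iu.
have x'0 l : l != k -> derive1 (coordinate x l) u = 0.
  move=> lk; rewrite -(derive1_cst (coordinate x l u) u).
  apply: derive1_near_eq; near=> v; apply: cst_coord => //.
  by near: v; exact: open_nbhs_nbhs.
rewrite (bigD1 k)//= [X in _ + (_ + X)]big1 => [|i ik]; last first.
  by rewrite big1// => j _; rewrite (x'0 i)// mulr0 mul0r.
rewrite (bigD1 k)//= big1 => [|j jk]; last by rewrite (x'0 j)// mulr0.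
rewrite !addr0 christoffel_orthogonal; last exact: gU.
by move/eqP; rewrite addr_eq0 => /eqP ->; rewrite expr2 mulrA.
Unshelve. all: by end_near. Qed.

(** The derivative of sqrt(H(y)) y' is
H'(y) y'^2 / (2 sqrt(H(y))) + sqrt(H(y)) y'', and the geodesic equation makes
the two terms cancel. *)
Lemma coordinate_line_speed_cst u v : I u -> I v ->
  Num.sqrt (H (coordinate x k u)) * derive1 (coordinate x k) u =
  Num.sqrt (H (coordinate x k v)) * derive1 (coordinate x k) v.
Proof.
apply: (interval_derive0_cst (f := fun w =>
  Num.sqrt (H (coordinate x k w)) * derive1 (coordinate x k) w)) => //.
move=> {}u Iu; have [Ux /(_ k)[dx dx' _]] := geo Iu.
have Hu := H_gt0 Ux.
have x'P : is_derive u 1 (coordinate x k) (derive1 (coordinate x k) u).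
  by rewrite derive1E; apply: derivableP.
have x''P : is_derive u 1 (derive1 (coordinate x k))
    (derive1 (derive1 (coordinate x k)) u).
  by rewrite [X in is_derive _ _ _ X]derive1E; apply: derivableP.
have H'P : is_derive (coordinate x k u) 1 H (derive1 H (x u 0 k)).
  by rewrite derive1E; apply: derivableP; exact: H_derivable.
have sP : is_derive (H (coordinate x k u)) 1 Num.sqrt _ := is_derive1_sqrt Hu.
have HxP := is_derive1_comp H'P x'P.
have sHxP := is_derive1_comp (f := Num.sqrt) (g := H \o coordinate x k) sP HxP.
have VP := is_deriveM sHxP x''P.
apply: is_derive_eq VP _.
rewrite coordinate_line_geodesic//= /coordinate/= /GRing.scale/=.
have s0 : Num.sqrt (H (x u 0 k)) != 0 by rewrite gt_eqF// sqrtr_gt0.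
(* Writing H as the square of its root makes the identity rational. *)
rewrite -[in X in 2 * X](sqr_sqrtr (ltW Hu)).
by field.
Qed.

End OrthogonalCoordinate.

(** * The Taub-NUT metric *)

Section TaubNUT.
Variables (R : realType) (n : R).

Definition radial_coef (r : R) : R := (r + n) / (r - n).
Definition radial_arclength (r : R) : R :=
  Num.sqrt (r ^+ 2 - n ^+ 2)
  + 2 * n * ln (Num.sqrt (r + n) + Num.sqrt (r - n)).

Lemma radial_coef_gt0 (r : R) : 0 < n -> n < r -> 0 < radial_coef r.
Proof. by move=> n_gt0 nr; apply: divr_gt0; lra. Qed.

Lemma taub_nut_metric_rrow (q : 'rV[R]_4) l :
  taub_nut_metric n q i_r l = if l == i_r then radial_coef (q 0 i_r) else 0.
Proof.
rewrite /taub_nut_metric !mxE !big_ord1 !mxE /=.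
by case: l => [[|[|[|[|//]]]] ?]; rewrite /= /radial_coef /eq_op/=; ring.
Qed.

Lemma taub_nut_metric_rcol (q : 'rV[R]_4) l :
  taub_nut_metric n q l i_r = if l == i_r then radial_coef (q 0 i_r) else 0.
Proof.
rewrite -taub_nut_metric_rrow.
rewrite /taub_nut_metric !mxE !big_ord1 !mxE /=.
ring.
Qed.

(** Since the metric is built from squares of covectors, its quadratic form is a
combination of squares of linear forms; this exhibits positive definiteness. *)
Lemma taub_nut_quadratic_form (q v : 'rV[R]_4) :
  (v *m taub_nut_metric n q *m v^T) 0 0 =
    (q 0 i_r - n) / (q 0 i_r + n)
      * (v 0 i_tau + 2 * n * cos (q 0 i_theta) * v 0 i_phi) ^+ 2
    + (q 0 i_r ^+ 2 - n ^+ 2)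
      * (v 0 i_theta ^+ 2 + (sin (q 0 i_theta) * v 0 i_phi) ^+ 2)
    + radial_coef (q 0 i_r) * v 0 i_r ^+ 2.
Proof.
have form (w : 'rV[R]_4) :
    (v *m covector_sq w *m v^T) 0 0 = ((v *m w^T) 0 0) ^+ 2.
  rewrite /covector_sq mulmxA -mulmxA.
  by rewrite mxE big_ord1 -[w *m v^T]trmxK trmx_mul trmxK [in X in _ * X]mxE.
have addE (A B : 'M[R]_1) : (A + B) 0 0 = A 0 0 + B 0 0 by rewrite mxE.
have scaleE a (A : 'M[R]_1) : (a *: A) 0 0 = a * A 0 0 by rewrite mxE.
have dcoordE k : v *m (dcoord R k)^T = (v 0 k)%:M.
  rewrite /dcoord trmx_delta -colE; apply/rowP => i.
  by rewrite !ord1 !mxE mulr1n.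
rewrite /taub_nut_metric !(mulmxDr, mulmxDl) -!(scalemxAr, scalemxAl).
rewrite !(mulmxDr, mulmxDl) -!(scalemxAr, scalemxAl).
rewrite !(addE, scaleE, form) linearD linearZ/= mulmxDr -scalemxAr !dcoordE.
by rewrite !(addE, scaleE) !mxE eqxx !mulr1n exprMn.
Qed.

(** A vector v of the kernel has quadratic form 0, so each of the squares
vanishes: v_theta = v_r = 0, then v_phi = 0 because sin theta > 0 away from the
poles, and finally v_tau = 0. *)
Lemma taub_nut_metric_unit (q : 'rV[R]_4) :
  0 < n -> taub_nut_chart n q -> taub_nut_metric n q \in unitmx.
Proof.
move=> n_gt0 [nr theta_pi].
rewrite -row_free_unit; apply: inj_row_free => v vG0.
have pos_def (f a h w y z u : R) : 0 < f -> 0 < a -> 0 < h ->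
    f * w ^+ 2 + a * (y ^+ 2 + z ^+ 2) + h * u ^+ 2 = 0 ->
    [/\ w = 0, y = 0, z = 0 & u = 0].
  move=> f0 a0 h0 sum0.
  have fw : 0 <= f * w ^+ 2 by rewrite mulr_ge0 ?sqr_ge0// ltW.
  have ayz : 0 <= a * (y ^+ 2 + z ^+ 2).
    by rewrite mulr_ge0 ?addr_ge0 ?sqr_ge0// ltW.
  have hu : 0 <= h * u ^+ 2 by rewrite mulr_ge0 ?sqr_ge0// ltW.
  have factor0 b e : 0 < b -> b * e = 0 -> e = 0.
    by move=> b0 /eqP; rewrite mulf_eq0 (gt_eqF b0) => /eqP.
  have /factor0 -/(_ f0)/eqP w0 : f * w ^+ 2 = 0 by lra.
  have /factor0 -/(_ a0)/eqP yz0 : a * (y ^+ 2 + z ^+ 2) = 0 by lra.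
  have /factor0 -/(_ h0)/eqP u0 : h * u ^+ 2 = 0 by lra.
  move: w0 yz0 u0; rewrite paddr_eq0 ?sqr_ge0// !sqrf_eq0.
  by move=> /eqP w0 /andP[/eqP y0 /eqP z0] /eqP u0.
have sin_gt0 : 0 < sin (q 0 i_theta) by exact: sin_gt0_pi.
have := taub_nut_quadratic_form q v; rewrite vG0 mul0mx mxE.
have := radial_coef_gt0 n_gt0 nr.
set h := radial_coef _; set c := cos _ ; set s := sin _ in sin_gt0 *.
set r := q 0 i_r in nr * => h_gt0.
have f_gt0 : 0 < (r - n) / (r + n) by apply: divr_gt0; lra.
have a_gt0 : 0 < r ^+ 2 - n ^+ 2 by rewrite subr_sqr; apply: mulr_gt0; lra.
move=> /esym/(pos_def _ _ _ _ _ _ _ f_gt0 a_gt0 h_gt0).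
move=> [v_tau v_theta /eqP + v_r].
rewrite mulf_eq0 (gt_eqF sin_gt0)/= => /eqP v_phi.
move: v_tau; rewrite v_phi mulr0 addr0 => v_tau.
apply/rowP => i; rewrite mxE.
have [-> | [-> | [-> | ->]]] : i = i_tau \/ i = i_r \/ i = i_theta \/ i = i_phi.
  case: i => [[|[|[|[|//]]]] ?];
    [left|right; left|do 2!right; left|do 3!right]; exact: val_inj.
all: by [].
Qed.

(** In terms of a = sqrt(r + n) and b = sqrt(r - n) both sides are rational:
r = (a^2 + b^2) / 2, n = (a^2 - b^2) / 2 and the derivative is a / b. *)
Lemma is_derive_radial_arclength (r : R) : 0 < n -> n < r ->
  is_derive r 1 radial_arclength (Num.sqrt (radial_coef r)).
Proof.
move=> n_gt0 nr.
have rn : 0 < r - n by lra.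
have rn' : 0 < r + n by lra.
have r2n2 : 0 < r ^+ 2 - n ^+ 2 by rewrite subr_sqr mulr_gt0.
have sDgt0 : 0 < Num.sqrt (r + n) + Num.sqrt (r - n).
  by rewrite addr_gt0// sqrtr_gt0.
have P1 : is_derive r 1 (fun y => y ^+ 2 - n ^+ 2) (2 * r).
  by apply: is_derive_eq; rewrite /= /GRing.scale/=; ring.
have P2 := is_derive1_comp (f := Num.sqrt) (g := fun y => y ^+ 2 - n ^+ 2)
  (is_derive1_sqrt r2n2) P1.
have P3 : is_derive r 1 (fun y => y + n) 1.
  by apply: is_derive_eq; rewrite addr0.
have P4 : is_derive r 1 (fun y => y - n) 1.
  by apply: is_derive_eq; rewrite subr0.
have P5 := is_derive1_comp (f := Num.sqrt) (g := fun y => y + n)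
  (is_derive1_sqrt rn') P3.
have P6 := is_derive1_comp (f := Num.sqrt) (g := fun y => y - n)
  (is_derive1_sqrt rn) P4.
have P7 := is_derive1_comp (f := @ln R)
  (g := fun y => Num.sqrt (y + n) + Num.sqrt (y - n))
  (is_derive1_ln sDgt0) (is_deriveD P5 P6).
have P8 := is_deriveD P2 (is_deriveZ (2 * n) P7).
apply: is_derive_eq P8 _.
rewrite /= /GRing.scale/=.
rewrite subr_sqr /radial_coef !sqrtrM ?sqrtrV ?ltW//.
have := sqr_sqrtr (ltW rn); have := sqr_sqrtr (ltW rn').
have : 0 < Num.sqrt (r - n) by rewrite sqrtr_gt0.
have : 0 < Num.sqrt (r + n) by rewrite sqrtr_gt0.
move: (Num.sqrt (r + n)) (Num.sqrt (r - n)) => a b a_gt0 b_gt0 a2 b2.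
have -> : r = (a ^+ 2 + b ^+ 2) / 2 by lra.
have -> : n = (a ^+ 2 - b ^+ 2) / 2 by lra.
by field; rewrite !gt_eqF// addr_gt0.
Qed.

(** At r = n every occurrence of r - n vanishes, leaving 2 n ln (sqrt (2 n)). *)
Lemma radial_arclength_cvg : 0 < n ->
  radial_arclength r @[r --> n^'+] --> n * ln (2 * n).
Proof.
move=> n_gt0.
have -> : n * ln (2 * n) = radial_arclength n.
  have n2_gt0 : 0 < 2 * n by lra.
  have -> : ln (2 * n) = ln (Num.sqrt (2 * n)) * 2.
    by rewrite -[in LHS](sqr_sqrtr (ltW n2_gt0)) lnXn ?sqrtr_gt0// mulr_natr.
  have nn : n + n = 2 * n by ring.
  by rewrite /radial_arclength !subrr sqrtr0 add0r addr0 nn; ring.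
apply: cvg_at_right_filter.
have sqrt_cvg (f : R -> R) : f r @[r --> n] --> f n ->
    Num.sqrt (f r) @[r --> n] --> Num.sqrt (f n).
  by move=> fn; apply: (continuous_comp fn); exact: sqrt_continuous.
have id_cvg : r @[r --> n] --> n by exact: cvg_id.
apply: cvgD.
  apply: (sqrt_cvg (fun r => r ^+ 2 - n ^+ 2)).
  by apply: cvgB; [exact: exprn_continuous|exact: cvg_cst].
apply: cvgMr.
apply: (@continuous_comp _ _ _
  (fun r : R => Num.sqrt (r + n) + Num.sqrt (r - n)) (@ln R)).
  apply: cvgD.
    by apply: (sqrt_cvg (fun r => r + n)); apply: cvgD; [|exact: cvg_cst].
  by apply: (sqrt_cvg (fun r => r - n)); apply: cvgB; [|exact: cvg_cst].
apply: continuous_ln; rewrite subrr sqrtr0 addr0 sqrtr_gt0; lra.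
Qed.

End TaubNUT.

(** * The radial geodesics *)

(* The radial coordinate approaches n only as a limit of the curve, since r = n
   lies outside the chart; t is the parameter as a function of the radial
   coordinate. The term - n * ln (2 * n) makes the bracket vanish at r = n:
   without it the right-hand side would not tend to t1 as r tends to n (unless
   2 * n = 1), contradicting the condition on the limit of t. *)
Theorem theorem3p1 (R : realType) (n : R) (I : set R) (x : R -> 'rV[R]_4)
    (t : R -> R) (t1 r1 : R) :
  0 < n ->
  open I -> is_interval I ->
  geodesic (taub_nut_metric n) (taub_nut_chart n) I x ->
  (forall k : 'I_4, k \in [:: i_theta; i_phi; i_tau] ->
     forall u v, I u -> I v -> coordinate x k u = coordinate x k v) ->
  closure (coordinate x i_r @` I) n ->
  (forall u, I u -> t (coordinate x i_r u) = u) ->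
  t r @[r --> n^'+] --> t1 ->
  Num.sqrt ((r + n) / (r - n)) * derive1 (coordinate x i_r) (t r) @[r --> n^'+]
    --> r1 ->
  forall r, (coordinate x i_r @` I) r ->
    t r = t1 + 1 / r1 *
               (Num.sqrt (r ^+ 2 - n ^+ 2)
                + 2 * n * ln (Num.sqrt (r + n) + Num.sqrt (r - n))
                - n * ln (2 * n)).
Proof.
move=> n_gt0 openI itvI geo cst_coord cl_n tK t_cvg v_cvg r [u0 Iu0 rho_u0].
set rho := coordinate x i_r in cl_n tK v_cvg rho_u0.
have rho_gt u : I u -> n < rho u by move=> /geo[[]].
have drho u : I u -> derivable rho u 1 by move=> /geo[_ /(_ i_r)[]].
pose c := Num.sqrt (radial_coef n (rho u0)) * derive1 rho u0.
have speed u : I u -> Num.sqrt (radial_coef n (rho u)) * derive1 rho u = c.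
  move=> Iu; apply: (coordinate_line_speed_cst
    (taub_nut_metric_rrow n) (taub_nut_metric_rcol n) openI itvI geo) => //.
  - move=> l lr; apply: cst_coord; rewrite !inE.
    by move: lr; case: l => [[|[|[|[|//]]]] ?].
  - by move=> q; exact: taub_nut_metric_unit.
  - by move=> q [nq _]; exact: radial_coef_gt0.
  - move=> q [nq _]; apply: derivableM; first exact: ex_derive.
    by apply: derivableV; rewrite ?subr_eq0 ?gt_eqF.
have radial_arclength_rho u v : I u -> I v ->
    radial_arclength n (rho u) - c * u = radial_arclength n (rho v) - c * v.
  apply: (interval_derive0_cst
    (f := fun u => radial_arclength n (rho u) - c * u)) => //.
  move=> {}u Iu.
  have rhoP : is_derive u 1 rho (derive1 rho u).
    by rewrite derive1E; apply: derivableP; exact: drho.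
  have P := is_derive1_comp
    (is_derive_radial_arclength n_gt0 (rho_gt _ Iu)) rhoP.
  have Q := is_deriveB P (is_deriveZ c (is_derive_id u 1)).
  by apply: is_derive_eq Q _; rewrite speed// /GRing.scale/= mulr1 subrr.
have image r' : n < r' -> r' <= r -> exists2 u, I u & rho u = r'.
  move=> nr' r'r.
  have itv_image : is_interval (rho @` I).
    apply/connected_intervalP; apply: connected_continuous_connected.
      exact/connected_intervalP.
    apply: continuous_in_subspaceT => u /set_mem Iu.
    by apply: differentiable_continuous; apply/derivable1_diffP; exact: drho.
  have [_ [[u Iu <-] /= ur']] := cl_n _ (lt_nbhsl nr').
  suff [v Iv <-] : (rho @` I) r' by exists v.
  apply: (itv_image (rho u) r); [by exists u|by exists u0|].
  by rewrite (ltW ur') r'r.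
have nr : n < r by rewrite -rho_u0; exact: rho_gt.
have c_neq0 : c != 0.
  apply/eqP => c0.
  have rho'0 u : I u -> is_derive u 1 rho 0.
    move=> Iu; apply: DeriveDef; first exact: drho.
    apply/eqP; have /eqP := speed _ Iu; rewrite c0 mulf_eq0 derive1E gt_eqF//.
    by rewrite sqrtr_gt0 radial_coef_gt0// rho_gt.
  have [u Iu] : exists2 u, I u & rho u = (n + r) / 2 by apply: image; lra.
  rewrite (interval_derive0_cst itvI rho'0 Iu Iu0) rho_u0; lra.
(* Near n on the right, the hypotheses on t apply to points of the curve. *)
have near_image : \forall r' \near n^'+, exists2 u, I u & rho u = r'.
  near=> r'; apply: image; near: r'; first exact: nbhs_right_gt.
  exact: nbhs_right_le.
have r1E : r1 = c.
  apply: (cvg_unique _ v_cvg) => //.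
  apply: (@cvg_trans _ (cst c r' @[r' --> n^'+])); last exact: cvg_cst.
  apply: near_eq_cvg; near=> r'.
  have [u Iu <-] : exists2 u, I u & rho u = r' by near: r'.
  by rewrite tK// -(speed u Iu).
have limE : n * ln (2 * n) - c * t1 = radial_arclength n r - c * u0.
  have lim1 :
      radial_arclength n r' - c * t r' @[r' --> n^'+] --> n * ln (2 * n) - c * t1.
    by apply: cvgB; [exact: radial_arclength_cvg|exact: cvgMr].
  apply: (cvg_unique _ lim1) => //.
  apply: (@cvg_trans _ (cst (radial_arclength n r - c * u0) r' @[r' --> n^'+])).
    apply: near_eq_cvg; near=> r'.
    have [u Iu <-] : exists2 u, I u & rho u = r' by near: r'.
    by rewrite tK// -rho_u0; exact: radial_arclength_rho.
  exact: cvg_cst.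
rewrite -/(radial_arclength n r) r1E -[in LHS]rho_u0 tK//.
have -> : radial_arclength n r - n * ln (2 * n) = c * (u0 - t1) by lra.
by field.
Unshelve. all: by end_near. Qed.
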